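(* Let $X$ be a Banach space (real or complex) with the alternative Daugavet property whose closed unit ball $B_X$ is an SCD set. Then $X$ is lush. In particular, every SCD Banach space with the alternative Daugavet property is lush.
   Context: $\mathbb{K}\in\{\mathbb{R},\mathbb{C}\}$ is the scalar field, $\mathbb{T}$ the set of scalars of modulus one, $S_X$ and $B_X$ the unit sphere and closed unit ball of $X$, $L(X)$ the bounded linear operators on $X$. For a convex bounded $A\subseteq X$, $x^*\in X^*$ and $\varepsilon>0$, the slice is $S(A,x^*,\varepsilon)=\{x\in A:\ \mathrm{Re}\,x^*(x)>\sup \mathrm{Re}\,x^*(A)-\varepsilon\}$. A convex bounded set $A\subseteq X$ is an SCD set if there is a sequence $(S_n)$ of slices of $A$ such that $A\subseteq\overline{\mathrm{conv}}(B)$ for every $B\subseteq A$ intersecting every $S_n$. A separable Banach space is an SCD space if every convex bounded subset of it is an SCD set. $X$ has the alternative Daugavet property if every rank-one $T\in L(X)$ satisfies $\max_{\theta\in\mathbb{T}}\|\mathrm{Id}+\theta T\|=1+\|T\|$. $X$ is lush if for every $x,y\in S_X$ and every $\varepsilon>0$ there is $x^*\in S_{X^*}$ such that the slice $S=S(B_X,x^*,\varepsilon)$ contains $x$ and $\mathrm{dist}(y,\mathrm{aconv}(S))<\varepsilon$, where $\mathrm{aconv}$ denotes the absolutely convex hull. *)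

(* Defs.v *)
From mathcomp Require Import all_boot all_order all_algebra.
From mathcomp Require Import all_classical all_reals all_analysis.
From mathcomp.real_closed Require Export complex.
Set Implicit Arguments. Unset Strict Implicit. Unset Printing Implicit Defensive.
Import Order.TTheory GRing.Theory Num.Theory.
Import numFieldNormedType.Exports.
Local Open Scope classical_set_scope.
Local Open Scope ring_scope.

(* Generic Banach-space notions over a scalar field K (K = R or K = R[i]).
   [re : K -> K] is the real-part map (id for K = R, 'Re for K = R[i]).
   Norms take values in K (they are real elements of K), and suprema are
   expressed through the least-upper-bound predicate in K. *)

Definition is_lub (K : numFieldType) (S : set K) (s : K) : Prop :=
  (forall t, S t -> t <= s) /\ (forall u, (forall t, S t -> t <= u) -> s <= u).

Definition is_max (K : numFieldType) (S : set K) (s : K) : Prop :=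
  S s /\ (forall t, S t -> t <= s).

Definition ball_X (K : numFieldType) (X : normedModType K) : set X :=
  [set x | `|x| <= 1].
Definition sphere_X (K : numFieldType) (X : normedModType K) : set X :=
  [set x | `|x| = 1].

Definition is_linear (K : numFieldType) (X Y : lmodType K) (f : X -> Y) : Prop :=
  forall (a : K) (x y : X), f (a *: x + y) = a *: f x + f y.

Definition bounded_op (K : numFieldType) (X Y : normedModType K) (T : X -> Y) :=
  is_linear T /\ continuous T.

Definition dual_elt (K : numFieldType) (X : normedModType K) (f : X -> K) :=
  is_linear (f : X -> K^o) /\ continuous f.

Definition opnorm_is (K : numFieldType) (X Y : normedModType K) (T : X -> Y) (c : K) :=
  is_lub [set `|T x| | x in @ball_X K X] c.

Definition dualnorm_is (K : numFieldType) (X : normedModType K) (f : X -> K) (c : K) :=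
  is_lub [set `|f x| | x in @ball_X K X] c.

Definition dual_sphere (K : numFieldType) (X : normedModType K) (f : X -> K) :=
  dual_elt f /\ dualnorm_is f 1.

Definition convex_set (K : numFieldType) (X : normedModType K) (A : set X) :=
  forall x y (t : K), A x -> A y -> 0 <= t -> t <= 1 -> A (t *: x + (1 - t) *: y).

Definition bounded_set (K : numFieldType) (X : normedModType K) (A : set X) :=
  exists M : K, forall x, A x -> `|x| <= M.

Definition conv (K : numFieldType) (X : normedModType K) (B : set X) : set X :=
  [set x | exists (n : nat) (c : 'I_n -> K) (p : 'I_n -> X),
     (forall i, 0 <= c i) /\ \sum_(i < n) c i = 1 /\ (forall i, B (p i)) /\
     x = \sum_(i < n) c i *: p i].

Definition aconv (K : numFieldType) (X : normedModType K) (B : set X) : set X :=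
  [set x | exists (n : nat) (c : 'I_n -> K) (p : 'I_n -> X),
     \sum_(i < n) `|c i| <= 1 /\ (forall i, B (p i)) /\
     x = \sum_(i < n) c i *: p i].

Definition cconv (K : numFieldType) (X : normedModType K) (B : set X) : set X :=
  closure (conv B).

Definition slice (K : numFieldType) (re : K -> K) (X : normedModType K)
    (A : set X) (f : X -> K) (eps : K) : set X :=
  [set x | A x /\ exists s, is_lub [set re (f a) | a in A] s /\ s - eps < re (f x)].

Definition is_slice_of (K : numFieldType) (re : K -> K) (X : normedModType K)
    (A S : set X) :=
  exists (f : X -> K) (eps : K), dual_elt f /\ 0 < eps /\ S = slice re A f eps.

Definition scd_set (K : numFieldType) (re : K -> K) (X : normedModType K) (A : set X) :=
  convex_set A /\ bounded_set A /\
  exists S : nat -> set X, (forall n, is_slice_of re A (S n)) /\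
    forall B : set X, B `<=` A -> (forall n, B `&` S n !=set0) -> A `<=` cconv B.

Definition separable (K : numFieldType) (X : normedModType K) :=
  exists d : nat -> X, closure (range d) = setT.

Definition scd_space (K : numFieldType) (re : K -> K) (X : normedModType K) :=
  separable X /\
  forall A : set X, convex_set A -> bounded_set A -> scd_set re A.

Definition rank_one (K : numFieldType) (X : normedModType K) (T : X -> X) :=
  bounded_op T /\ (exists x, T x != 0) /\
  exists y : X, forall x, exists a : K, T x = a *: y.

Definition alt_daugavet (K : numFieldType) (X : normedModType K) :=
  forall T : X -> X, rank_one T -> forall nT, opnorm_is T nT ->
    is_max [set r | exists theta : K, `|theta| = 1 /\
                      opnorm_is (fun x => x + theta *: T x) r] (1 + nT).

Definition lush (K : numFieldType) (re : K -> K) (X : normedModType K) :=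
  forall x y : X, @sphere_X K X x -> @sphere_X K X y -> forall eps : K, 0 < eps ->
    exists f : X -> K, dual_sphere f /\
      slice re (@ball_X K X) f eps x /\
      exists z, aconv (slice re (@ball_X K X) f eps) z /\ `|y - z| < eps.

(* Main.v *)
(** Let [x], [y] be unit vectors and [S_n] slices witnessing that the ball is an SCD
    set. Applying the alternative Daugavet property to the operator
    [z |-> h (z) w], with [h] the functional of a slice [S] and [w] an arbitrary
    non-zero vector, gives [u] in [S] and a scalar [v] of modulus one such that [|w + v u|] is almost
    [|w| + 1]. Iterating from [w_0 = x] yields [u_n] in [S_n] and
    [w_(n+1) = w_n + v_n u_n] with [|w_n| > n + 1 - d]. A single Hahn-Banach
    argument produces a norm-one functional [h] with [Re h (x)] and all
    [Re h (v_n u_n)] at least [1 - d], which replaces the usual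
    Krein-Milman-Baire argument on the dual ball. The slice defined by [h]
    contains [x] and a rotation of each [u_n]; since the [u_n] meet every [S_n],
    the absolutely convex hull of that slice is dense in the ball. *)
From HB Require Import structures.
Require Import Defs.
From mathcomp Require Import all_boot all_order all_algebra.
From mathcomp Require Import all_classical all_reals all_analysis.
From mathcomp.real_closed Require Import complex.
From mathcomp Require Import ring lra.
Set Implicit Arguments. Unset Strict Implicit. Unset Printing Implicit Defensive.
Import Order.TTheory GRing.Theory Num.Theory.
Import numFieldNormedType.Exports.
Local Open Scope ring_scope.
Local Open Scope classical_set_scope.

(** * Sublinear functionals and the Hahn-Banach theorem *)

Section HahnBanach.
Context {R : realType} {K : numFieldType} (i : {rmorphism R -> K}).

(** Homogeneity is asked only as an inequality for [t > 0]; using it with [t^-1] gives equality. *)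
Definition sublinear (V : lmodType K) (q : V -> R) : Prop :=
  (forall x y, q (x + y) <= q x + q y) /\
  (forall t x, 0 < t -> q (i t *: x) <= t * q x).

Definition real_linear (V : lmodType K) (g : V -> R) : Prop :=
  (forall x y, g (x + y) = g x + g y) /\ (forall t x, g (i t *: x) = t * g x).

Context {V : lmodType K}.
Implicit Types (p q g : V -> R) (C : set (V * R)) (x y : V).

Lemma sublinear0 q : sublinear q -> q 0 = 0.
Proof.
move=> [/(_ 0 0) qD /(_ 2^-1 0)]; rewrite addr0 scaler0 in qD *.
have h : (0 : R) < 2^-1 by lra.
by move=> /(_ h); lra.
Qed.

Lemma sublinear_ge q x : sublinear q -> - q (- x) <= q x.
Proof.
move=> q_sub; have := sublinear0 q_sub.
by have := q_sub.1 x (- x); rewrite subrr; lra.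
Qed.

(** Shared by the two pointwise infima below: over the translates by a cone, and over a chain of
    sublinear functionals. *)
Lemma sublinear_inf (E : V -> set R) :
    (forall x, has_inf (E x)) ->
    (forall x y a b, E x a -> E y b -> exists2 c, E (x + y) c & c <= a + b) ->
    (forall t x a, 0 < t -> E x a -> exists2 c, E (i t *: x) c & c <= t * a) ->
  sublinear (fun x => inf (E x)).
Proof.
move=> Einf EB EZ; split=> [x y|t x t0]; apply/ler_addgt0Pr => e e0.
  have e20 : 0 < e / 2 by lra.
  have [a Ea alt] := inf_adherent e20 (Einf x).
  have [b Eb blt] := inf_adherent e20 (Einf y).
  have [c Ec cle] := EB _ _ _ _ Ea Eb.
  have := ge_inf (Einf (x + y)).2 Ec; lra.
have [a Ea alt] := inf_adherent (divr_gt0 e0 t0) (Einf x).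
have [c Ec cle] := EZ _ _ _ t0 Ea.
apply: le_trans (ge_inf (Einf _).2 Ec) (le_trans cle _).
rewrite -ler_pdivlMl// mulrDr mulKf ?gt_eqF// mulrC; exact: ltW.
Qed.

(** A pair [(x, a)] of the cone stands for the constraint [a <= g x] on a functional [g] to be
    found. *)
Definition convex_cone C : Prop :=
  [/\ C (0, 0),
      forall c d, C c -> C d -> C (c.1 + d.1, c.2 + d.2) &
      forall t c, 0 < t -> C c -> C (i t *: c.1, t * c.2)].

(** Take [q' x] to be the infimum of [q (x + c.1) - c.2] over [c] in [C]. It is finite because
    subadditivity and [c.2 <= q c.1] bound these numbers below by [- q (- x)]. *)
Lemma sublinear_below_cone C q : sublinear q -> convex_cone C ->
    (forall c, C c -> c.2 <= q c.1) ->
  exists2 q', sublinear q' & (forall x, q' x <= q x) /\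
    forall c x, C c -> q' x <= q (x + c.1) - c.2.
Proof.
move=> q_sub [C0 CD CZ] Cq.
pose E x := [set q (x + c.1) - c.2 | c in C].
have Einf x : has_inf (E x).
  split; first by exists (q (x + 0) - 0), (0, 0).
  exists (- q (- x)) => _ [c Cc <-].
  have := q_sub.1 (x + c.1) (- x); rewrite addrAC subrr add0r.
  by have := Cq _ Cc; lra.
exists (fun x => inf (E x)).
  apply: sublinear_inf => // [x y _ _ [c Cc <-] [d Cd <-]|t x _ t0 [c Cc <-]].
    exists (q (x + y + (c.1 + d.1)) - (c.2 + d.2)).
      by exists (c.1 + d.1, c.2 + d.2) => //; exact: CD.
    by have := q_sub.1 (x + c.1) (y + d.1); rewrite addrACA; lra.
  exists (q (i t *: x + i t *: c.1) - t * c.2).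
    by exists (i t *: c.1, t * c.2) => //; exact: CZ.
  by rewrite -scalerDr mulrBr lerB// q_sub.2.
have le c x : C c -> inf (E x) <= q (x + c.1) - c.2.
  by move=> Cc; apply: ge_inf (Einf x).2 _ _; exists c.
by split=> // x; have := le _ x C0; rewrite /= addr0 subr0.
Qed.

Lemma sublinear_minimal p : sublinear p ->
  exists q, [/\ sublinear q, forall x, q x <= p x &
    forall q', sublinear q' -> (forall x, q' x <= q x) -> q' = q].
Proof.
move=> p_sub.
pose T := {q | sublinear q /\ forall x, q x <= p x}.
(* The order is reversed, so that a maximal element for Zorn's lemma is a minimal functional. *)
pose r (q q' : T) : bool := `[< forall x, sval q' x <= sval q x >].
have [||||[q [q_sub qp]] qmin] := @Zorn T r.
- by move=> q; apply/asboolP.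
- move=> q1 q2 q3 /asboolP le12 /asboolP le23; apply/asboolP => x.
  exact: le_trans (le23 x) (le12 x).
- move=> [q1 P1] [q2 P2] /asboolP /= le12 /asboolP /= le21.
  apply: eq_exist; apply/funext => x; apply/eqP.
  by rewrite eq_le le12 le21.
- move=> A Atot; have [->|/set0P[q0 Aq0]] := eqVneq A set0.
    by exists (exist _ p (conj p_sub (fun=> lexx _))) => s [].
  pose E x := [set sval s x | s in A].
  have Einf x : has_inf (E x).
    split; first by exists (sval q0 x), q0.
    exists (- p (- x)) => _ [[s [s_sub sp]] _ <-] /=.
    by have := sublinear_ge x s_sub; have := sp (- x); lra.
  have le s x : A s -> inf (E x) <= sval s x.
    by move=> As; apply: ge_inf (Einf x).2 _ _; exists s.
  have E_sub : sublinear (fun x => inf (E x)).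
    apply: sublinear_inf => // [x y _ _ [s As <-] [s' As' <-]|t x _ t0 [s As <-]].
      (* Of two members of the chain, the smaller one witnesses subadditivity. *)
      have [/asboolP ss'|/asboolP s's] := Atot _ _ As As'.
        exists (sval s' (x + y)); first by exists s'.
        by have := (svalP s').1.1 x y; have := ss' x; lra.
      exists (sval s (x + y)); first by exists s.
      by have := (svalP s).1.1 x y; have := s's y; lra.
    by exists (sval s (i t *: x)); [exists s|exact: (svalP s).1.2].
  have E_le x : inf (E x) <= p x.
    exact: le_trans (le q0 x Aq0) ((svalP q0).2 x).
  exists (exist _ (fun x => inf (E x)) (conj E_sub E_le)) => s As.
  by apply/asboolP => x; exact: le.
exists q; split=> // q' q'_sub q'q.
have q'p : sublinear q' /\ forall x, q' x <= p x.
  by split=> // x; apply: le_trans (qp x).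
have /(congr1 sval) : exist _ q' q'p = exist _ q (conj q_sub qp) :> T.
  by apply: qmin; apply/asboolP.
by [].
Qed.

Lemma minimal_sublinear_linear q : sublinear q ->
    (forall q', sublinear q' -> (forall x, q' x <= q x) -> q' = q) ->
  real_linear q.
Proof.
move=> q_sub qmin.
have q0 := sublinear0 q_sub.
have qZ t x : 0 < t -> q (i t *: x) = t * q x.
  move=> t0; apply/eqP; rewrite eq_le q_sub.2//= -ler_pdivlMl//.
  have ti : 0 < t^-1 by rewrite invr_gt0.
  have := q_sub.2 _ (i t *: x) ti.
  by rewrite scalerA -rmorphM mulVf ?gt_eqF// rmorph1 scale1r.
have qD x y : q (x + y) = q x + q y.
  apply/eqP; rewrite eq_le q_sub.1/=.
  (* Minimality makes [q] insensitive to being lowered along the ray of [x]. *)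
  pose C : set (V * R) := [set c | exists2 t, 0 <= t & c = (i t *: x, t * q x)].
  have [| |q' q'_sub [q'q q'C]] := @sublinear_below_cone C q q_sub.
  - split=> [|_ _ [t t0 ->] [s s0 ->]|t _ t0 [s s0 ->]].
    + by exists 0 => //; rewrite rmorph0 scale0r mul0r.
    + by exists (t + s); [exact: addr_ge0|rewrite /= rmorphD scalerDl mulrDl].
    + exists (t * s); first by rewrite mulr_ge0// ltW.
      by rewrite /= scalerA rmorphM mulrA.
  - move=> c [t]; rewrite le_eqVlt => /predU1P[<- ->|t0 ->]/=.
      by rewrite rmorph0 scale0r mul0r q0.
    by rewrite qZ.
  rewrite (qmin _ q'_sub q'q) in q'C.
  (* The point of parameter 1 on the ray gives [q y <= q (y + x) - q x], the missing half of
     additivity. *)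
  have /(q'C _ y) : C (x, q x) by exists 1 => //; rewrite rmorph1 scale1r mul1r.
  by rewrite /= (addrC y); lra.
have qN x : q (- x) = - q x.
  by have := qD x (- x); rewrite subrr q0; lra.
split=> // t x; have [t0|t0|->] := ltgtP t 0; last by rewrite rmorph0 scale0r q0 mul0r.
  have nt : 0 < - t by lra.
  by have := qZ _ x nt; rewrite rmorphN scaleNr qN; lra.
exact: qZ.
Qed.

(* The Mazur-Orlicz form of the Hahn-Banach theorem. *)
Lemma Hahn_Banach_cone C p : sublinear p -> convex_cone C ->
    (forall c, C c -> c.2 <= p c.1) ->
  exists2 g, real_linear g & (forall x, g x <= p x) /\
    forall c, C c -> c.2 <= g c.1.
Proof.
move=> p_sub C_cone Cp.
have [q q_sub [qp qC]] := sublinear_below_cone p_sub C_cone Cp.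
have [g [g_sub gq gmin]] := sublinear_minimal q_sub.
have g_lin := minimal_sublinear_linear g_sub gmin.
exists g => //; split=> [x|]; first exact: le_trans (gq x) (qp x).
(* At the point [- c.1] the bound on [q] reads [g (- c.1) <= p 0 - c.2], which is the constraint of
   [c]. *)
move=> c Cc; have := le_trans (gq (- c.1)) (qC _ _ Cc).
rewrite addNr (sublinear0 p_sub).
by have := sublinear_ge (- c.1) g_sub; rewrite opprK; lra.
Qed.

End HahnBanach.

(** * Real and complex scalars *)

(* [i] embeds the reals into the scalars and [re] is the real part;
   [sf_lift] turns a real functional into the real part of a [K]-linear one. *)
Record scalar_field (R : realType) (K : numFieldType) (i : {rmorphism R -> K})
    (re : K -> R) : Prop := ScalarField {
  sf_le : {mono i : a b / a <= b};
  sf_real : forall z, z \is Num.real -> i (re z) = z;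
  sf_reD : forall y z, re (y + z) = re y + re z;
  sf_reZ : forall a z, re (i a * z) = a * re z;
  sf_re_le : forall z, i (re z) <= `|z|;
  sf_lift : forall (X : lmodType K) (g : X -> R), real_linear i g ->
    exists2 f : X -> K, is_linear (f : X -> K^o) & forall x, re (f x) = g x }.

Section ScalarField.
Context {R : realType} {K : numFieldType} {i : {rmorphism R -> K}} {re : K -> R}.
Context (sf : scalar_field i re).
Implicit Types (a b t : R) (z : K).

Lemma scalar_lt : {mono i : a b / a < b}.
Proof. exact: leW_mono (sf_le sf). Qed.

Lemma scalar_real a : i a \is Num.real.
Proof.
by rewrite realE -(rmorph0 i) !(sf_le sf) le_total.
Qed.

Lemma scalar_reK : cancel i re.
Proof. by move=> a; apply: (fmorph_inj i); rewrite (sf_real sf)// scalar_real. Qed.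

Lemma scalar_norm a : `|i a| = i `|a|.
Proof.
have [a0|a0] := leP 0 a.
  by rewrite !ger0_norm// -(rmorph0 i) (sf_le sf).
by rewrite !ltr0_norm ?rmorphN// -(rmorph0 i) scalar_lt.
Qed.

Lemma scalar_gt0 z : 0 < z -> exists2 a, 0 < a & z = i a.
Proof.
move=> z0; have zE : i (re z) = z by rewrite (sf_real sf)// gtr0_real.
by exists (re z) => //; rewrite -scalar_lt rmorph0 zE.
Qed.

Lemma unit_scalar_mul z : exists2 u : K, `|u| = 1 & u * z = `|z|.
Proof.
have [->|z0] := eqVneq z 0; first by exists 1; rewrite ?normr1 ?mulr0 ?normr0.
exists (`|z| / z); last by rewrite divfK.
by rewrite normrM normfV normr_id divff// normr_eq0.
Qed.

(** The norm takes values in [K]; moving it to [R] gives access to suprema and to real linear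
    arithmetic. *)
Definition rnorm (V : normedZmodType K) (x : V) : R := re `|x|.

Lemma rnormE (V : normedZmodType K) (x : V) : i (rnorm x) = `|x|.
Proof. by rewrite (sf_real sf)// normr_real. Qed.

Lemma rnorm_ge0 (V : normedZmodType K) (x : V) : 0 <= rnorm x.
Proof. by rewrite -(sf_le sf) rmorph0 rnormE. Qed.

Lemma rnorm_gt0 (V : normedZmodType K) (x : V) : (0 < rnorm x) = (x != 0).
Proof. by rewrite -scalar_lt rmorph0 rnormE normr_gt0. Qed.

Lemma rnorm0 (V : normedZmodType K) : rnorm (0 : V) = 0.
Proof. by apply: (fmorph_inj i); rewrite rnormE normr0 rmorph0. Qed.

Lemma rnormN (V : normedZmodType K) (x : V) : rnorm (- x) = rnorm x.
Proof. by rewrite /rnorm normrN. Qed.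

Lemma ler_rnormD (V : normedZmodType K) (x y : V) : rnorm (x + y) <= rnorm x + rnorm y.
Proof. by rewrite -(sf_le sf) rmorphD !rnormE ler_normD. Qed.

Lemma rnormM (z z' : K) : rnorm (z * z') = rnorm z * rnorm z'.
Proof. by apply: (fmorph_inj i); rewrite rmorphM !rnormE normrM. Qed.

Lemma rnorm_scalar a : rnorm (i a) = `|a|.
Proof. by apply: (fmorph_inj i); rewrite rnormE scalar_norm. Qed.

Lemma is_lub_sup (T : Type) (A : set T) (F : T -> R) :
  has_sup [set F x | x in A] ->
    is_lub [set i (F x) | x in A] (i (sup [set F x | x in A])).
Proof.
move=> Fsup; split=> [_ [x Ax <-]|u u_ub].
  by rewrite (sf_le sf); apply: ub_le_sup Fsup.2 _ _; exists x.
have [_ [x0 Ax0 _]] := Fsup.1.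
have uE : i (re u) = u.
  (* An upper bound [u] in [K] is real because it is comparable with the real scalar [i (F x0)]. *)
  rewrite (sf_real sf)//; have := u_ub (i (F x0)).
  rewrite -subr_ge0 => /(_ _)/ger0_real; rewrite realBC => ur.
  rewrite -[u](subrK (i (F x0))) realD ?scalar_real// realBC ur//.
  by exists x0.
rewrite -uE (sf_le sf) ge_sup//; first exact: Fsup.1.
by move=> _ [x Ax <-]; rewrite -(sf_le sf) uE; apply: u_ub; exists x.
Qed.

Lemma is_lub_approx (T : Type) (A : set T) (F : T -> R) s e : A !=set0 -> 0 < e ->
  is_lub [set i (F x) | x in A] (i s) -> exists2 x, A x & s - e < F x.
Proof.
move=> [x0 Ax0] e0 [_ s_le]; apply: contrapT => noF.
suff : i s <= i (s - e) by rewrite (sf_le sf); lra.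
apply: s_le => _ [x Ax <-]; rewrite (sf_le sf) leNgt; apply/negP => lt.
by apply: noF; exists x.
Qed.

Lemma rnormZ (V : normedModType K) z (x : V) : rnorm (z *: x) = rnorm z * rnorm x.
Proof. by apply: (fmorph_inj i); rewrite rmorphM !rnormE normrZ. Qed.

Lemma rnormZ_unit (V : normedModType K) z (x : V) : `|z| = 1 -> rnorm (z *: x) = rnorm x.
Proof. by move=> z1; rewrite /rnorm normrZ z1 mul1r. Qed.

Lemma rnormZ_ge0 (V : normedModType K) t (x : V) :
  0 <= t -> rnorm (i t *: x) = t * rnorm x.
Proof. by move=> t0; rewrite rnormZ rnorm_scalar ger0_norm. Qed.

(** * Bounded functionals, the dual sphere and slices of the ball *)

Section NormedModule.
Context {X : normedModType K}.
Implicit Types (x y w : X) (f : X -> K).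

Lemma in_ballE x : ball_X (X := X) x = (rnorm x <= 1) :> Prop.
Proof. by rewrite /ball_X /= -rnormE -(rmorph1 i) (sf_le sf). Qed.

Lemma rnorm_sphere x : sphere_X x -> rnorm x = 1.
Proof. by move=> x1; apply: (fmorph_inj i); rewrite rnormE rmorph1. Qed.

Lemma is_linearD f : is_linear (f : X -> K^o) -> {morph f : x y / x + y}.
Proof. by move=> fL x y; have := fL 1 x y; rewrite !scale1r. Qed.

Lemma is_linear0 f : is_linear (f : X -> K^o) -> f 0 = 0.
Proof. by move=> /is_linearD/(_ 0 0)/eqP; rewrite addr0 addrC -subr_eq subrr => /eqP. Qed.

Lemma is_linearZ f : is_linear (f : X -> K^o) -> forall z x, f (z *: x) = z * f x.
Proof.
by move=> fL z x; have := fL z x 0; rewrite (is_linear0 fL) !addr0.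
Qed.

Lemma dual_elt_bounded f : dual_elt f -> exists M, forall x, ball_X x -> rnorm (f x) <= M.
Proof.
move=> [fL fC].
pose F : {linear X -> K^o} := HB.pack (f : X -> K^o) (GRing.isLinear.Build _ _ _ _ _ fL).
have /linear_bounded_continuous/linear_boundedP : continuous F by exact: fC.
move=> /pinfty_ex_gt0[M M0 fM].
exists (re M) => x; rewrite -(sf_le sf) rnormE (sf_real sf) ?gtr0_real// => x1.
apply: le_trans (fM x) _.
by rewrite ler_piMr// ltW.
Qed.

Lemma rnorm_bounded_continuous (W : normedModType K) (f : X -> W) (M : R) :
  is_linear f -> (forall x, rnorm (f x) <= M * rnorm x) -> continuous f.
Proof.
move=> fL fM.
pose F : {linear X -> W} := HB.pack f (GRing.isLinear.Build _ _ _ _ _ fL).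
suff : continuous F by [].
apply/linear_bounded_continuous/linear_boundedP.
near=> r => x; apply: (@le_trans _ _ (i M * `|x|)).
  by rewrite -!rnormE -rmorphM (sf_le sf).
rewrite ler_wpM2r//; near: r; apply: nbhs_pinfty_ge; exact: scalar_real.
Unshelve. all: by end_near. Qed.

Lemma ler_rnorm_linear (W : normedModType K) (f : X -> W) (M : R) :
    is_linear f -> (forall x, ball_X x -> rnorm (f x) <= M) ->
  forall x, rnorm (f x) <= M * rnorm x.
Proof.
move=> fL fM x.
pose F : {linear X -> W} := HB.pack f (GRing.isLinear.Build _ _ _ _ _ fL).
have f0 : f 0 = 0 := linear0 F.
have fZ z : f (z *: x) = z *: f x := linearZ_LR F z x.
have [->|x0] := eqVneq x 0; first by rewrite f0 !rnorm0 mulr0.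
have nx0 : 0 < rnorm x by rewrite rnorm_gt0.
have /fM : ball_X (i (rnorm x)^-1 *: x).
  by rewrite in_ballE rnormZ_ge0 ?mulVf ?gt_eqF// invr_ge0 ltW.
rewrite fZ rnormZ_ge0 ?invr_ge0 ?(ltW nx0)//.
by rewrite ler_pdivrMl// mulrC.
Qed.

Lemma dual_sphere_le f x : dual_sphere f -> rnorm (f x) <= rnorm x.
Proof.
move=> [[fL _] [f_le _]]; rewrite -[leRHS]mul1r.
apply: (@ler_rnorm_linear K^o f 1 fL) => y y1.
by rewrite -(sf_le sf) rnormE rmorph1; apply: f_le; exists y.
Qed.

(** Here [M] is the supremum of [|f|] on the ball, positive since [f x0 != 0], and [h] is [f / M].
    Slices of nonzero functionals are thereby reduced to norm-one functionals. *)
Lemma dual_normalize f x0 : dual_elt f -> f x0 != 0 ->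
  exists M h, [/\ 0 < M, dualnorm_is f (i M), dual_sphere h &
    forall x, f x = i M * h x].
Proof.
move=> fD fx0; have [fL _] := fD.
have [N fN] := dual_elt_bounded fD.
have fsup : has_sup [set rnorm (f x) | x in @ball_X K X].
  split; last by exists N => _ [x x1 <-]; exact: fN.
  by exists (rnorm (f 0)), 0 => //; rewrite in_ballE rnorm0.
have f_lub : dualnorm_is f (i (sup [set rnorm (f x) | x in @ball_X K X])).
  rewrite /dualnorm_is.
  have -> : (fun x => `|f x|) = (fun x => i (rnorm (f x))).
    by apply/funext => x; rewrite rnormE.
  exact: is_lub_sup.
set M := sup _ in f_lub.
have fM x : ball_X x -> rnorm (f x) <= M.
  by move=> x1; rewrite -(sf_le sf) rnormE; apply: f_lub.1; exists x.
have fMx := @ler_rnorm_linear K^o f M fL fM.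
have M0 : 0 < M.
  rewrite ltNge; apply/negP => M0.
  have : 0 < rnorm (f x0) by rewrite rnorm_gt0.
  rewrite ltNge => /negP; apply; apply: le_trans (fMx x0) _.
  by rewrite mulr_le0_ge0// rnorm_ge0.
have iM0 : 0 < i M by rewrite -(rmorph0 i) scalar_lt.
exists M, (fun x => i M^-1 * f x); split=> //; last first.
  by move=> x; rewrite mulrA -rmorphM divff ?gt_eqF// rmorph1 mul1r.
have hL : is_linear ((fun x => i M^-1 * f x) : X -> K^o).
  move=> z x y; rewrite fL /GRing.scale /= mulrDr; congr (_ + _).
  by rewrite mulrCA.
split; first split=> //.
  apply: (@rnorm_bounded_continuous K^o _ 1 hL) => x.
  have := fMx x; rewrite /= -ler_pdivrMl// mul1r; apply: le_trans.
  by rewrite rnormM rnorm_scalar ger0_norm// invr_ge0 ltW.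
have iMV : `|i M^-1| = (i M)^-1 by rewrite fmorphV ger0_norm// invr_ge0 ltW.
split=> [_ [x x1 <-]|u u_ub].
  rewrite normrM iMV ler_pdivrMl// mulr1 -rnormE (sf_le sf); exact: fM.
suff : i M <= i M * u by rewrite ler_pMr.
apply: f_lub.2 => _ [x x1 <-]; rewrite -ler_pdivrMl// -iMV -normrM.
by apply: u_ub; exists x.
Qed.

(** The ball is stable under rotation by unit scalars, and a rotation makes [h x] equal to its
    modulus; so the real part and the modulus of [h] have the same supremum. *)
Lemma dual_sphere_re h : dual_sphere h ->
  is_lub [set i (re (h x)) | x in @ball_X K X] 1.
Proof.
move=> hS; have [[hL _] [h_le h_lub]] := hS.
split=> [_ [x x1 <-]|u u_ub].
  by apply: le_trans (sf_re_le sf _) _; apply: h_le; exists x.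
apply: h_lub => _ [x x1 <-].
have [v v1 vE] := unit_scalar_mul (h x).
rewrite -rnormE /rnorm -vE -(is_linearZ hL); apply: u_ub; exists (v *: x) => //.
by move: x1; rewrite !in_ballE rnormZ_unit.
Qed.

(** The supremum of the real part of [M h] on the ball is [M], so width [e] for [M h] is width
    [e / M] for [h]. *)
Lemma slice_dual_sphere h M e u : dual_sphere h -> 0 < M -> ball_X u ->
    1 - e / M < re (h u) ->
  slice (fun z => i (re z)) (@ball_X K X) (fun x => i M * h x) (i e) u.
Proof.
move=> hS M0 u1 hu; split=> //; exists (i M); split; last first.
  rewrite (sf_reZ sf) -rmorphB scalar_lt -ltr_pdivrMl//.
  by rewrite mulrBr mulVf ?gt_eqF// mulrC.
have iM0 : 0 < i M by rewrite -(rmorph0 i) scalar_lt.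
have [h_le h_lub] := dual_sphere_re hS.
split=> [_ [x x1 <-]|b b_ub].
  rewrite (sf_reZ sf) rmorphM ler_piMr ?(ltW iM0)//; apply: h_le.
  by exists x.
suff : 1 <= (i M)^-1 * b by rewrite ler_pdivlMl// mulr1.
apply: h_lub => _ [x x1 <-]; rewrite ler_pdivlMl// -rmorphM -(sf_reZ sf).
by apply: b_ub; exists x.
Qed.

End NormedModule.
End ScalarField.

(** * From the alternative Daugavet property to lushness *)

Section Lush.
Context {R : realType} {K : numFieldType} {i : {rmorphism R -> K}} {re : K -> R}.
Context (sf : scalar_field i re).
Local Notation rnorm := (@rnorm R K re _).
Local Notation rk := (fun z : K => i (re z)).
Context {X : normedModType K}.

Lemma adp_dual_sphere (h : X -> K) (w : X) (e : R) :
    alt_daugavet X -> dual_sphere h -> w != 0 -> 0 < e ->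
  exists u v, [/\ ball_X u, 1 - e < re (h u), `|v| = 1 &
    rnorm w + 1 - e < rnorm (w + v *: u)].
Proof.
move=> adp hS w0 e0; have [[hL _] h_lub] := hS.
have nw0 : 0 < rnorm w by rewrite (rnorm_gt0 sf).
pose T x := h x *: w.
have TL : is_linear T.
  by move=> z x y; rewrite /T hL scalerDl scalerA.
have T_le x : rnorm (T x) <= rnorm w * rnorm x.
  by rewrite (rnormZ sf) mulrC; apply: ler_wpM2l; [exact: ltW|exact: (dual_sphere_le sf)].
have T_op : opnorm_is T (i (rnorm w)).
  split=> [_ [x x1 <-]|u u_ub].
    rewrite -(rnormE sf) (sf_le sf); apply: le_trans (T_le x) _.
    by rewrite ler_piMr// ?(rnorm_ge0 sf)// -(in_ballE sf).
  rewrite (rnormE sf) -[leRHS](@mulfVK _ `|w|) ?normr_eq0//.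
  rewrite ler_peMl//; apply: h_lub.2 => _ [x x1 <-].
  rewrite ler_pdivlMr ?normr_gt0// -normrZ; apply: u_ub.
  by exists x.
have T_rank : rank_one T.
  split; [split=> //|split].
  - exact: (rnorm_bounded_continuous sf TL T_le).
  - apply: contrapT => T0; suff : (1 : K) <= 0 by rewrite ler10.
    apply: h_lub.2 => _ [x x1 <-]; rewrite normr_le0.
    have [//|hx] := eqVneq (h x) 0; case: T0; exists x.
    by rewrite scaler_eq0 negb_or hx.
  - by exists w => x; exists (h x).
have [[t [t1]] + _] := adp T T_rank _ T_op.
have -> : 1 + i (rnorm w) = i (1 + rnorm w) by rewrite rmorphD rmorph1.
rewrite /opnorm_is.
under eq_fun do rewrite -(rnormE sf).
(* The bound [e * rnorm w] yields [1 - e < |h u|] after division by [rnorm w]; the bound [e / 2]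
   covers two losses of at most [a] in the norm estimate. *)
pose a := Num.min (e / 2) (e * rnorm w).
have a0 : 0 < a by rewrite lt_min; apply/andP; split; [lra|exact: mulr_gt0].
have ball0 : @ball_X K X !=set0 by exists 0; rewrite (in_ballE sf) (rnorm0 sf).
move=> /(is_lub_approx sf ball0 a0)[u u1 lt_u].
have [v v1 vE] := unit_scalar_mul (h u).
have hu1 : rnorm (h u) <= 1.
  apply: le_trans (dual_sphere_le sf u hS) _; by rewrite -(in_ballE sf).
have t0 : t != 0 by rewrite -normr_gt0 t1.
have v0 : v != 0 by rewrite -normr_gt0 v1.
have ae : a <= e / 2 by rewrite ge_min lexx.
have aw : a <= e * rnorm w by rewrite ge_min lexx orbT.
have huE : h u = v^-1 * i (rnorm (h u)) by rewrite (rnormE sf) -vE mulKf.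
have hu_w : rnorm (u + t *: T u) <= 1 + rnorm (h u) * rnorm w.
  apply: le_trans (ler_rnormD sf _ _) _.
  by rewrite (rnormZ_unit _ t1) (rnormZ sf) lerD2r -(in_ballE sf).
(* Up to a unit factor, [u + t T u] is the desired vector plus an error of norm [(1 - |h u|) |w|],
   which [hu_w] makes smaller than [a]. *)
have uE : u + t *: T u =
    (t / v) *: ((w + t^-1 *: (v *: u)) + i (rnorm (h u) - 1) *: w).
  rewrite rmorphB rmorph1 scalerBl scale1r [_ - w]addrC addrACA subrr add0r.
  rewrite scalerDr !scalerA {1}huE mulrA.
  by rewrite [t / v / t]mulrAC divff// mul1r mulVf// scale1r.
have wE : rnorm (u + t *: T u) <=
    rnorm (w + t^-1 *: (v *: u)) + (1 - rnorm (h u)) * rnorm w.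
  rewrite uE rnormZ_unit ?normrM ?normfV ?t1 ?v1 ?divr1//.
  apply: le_trans (ler_rnormD sf _ _) _.
  by rewrite lerD2l (rnormZ sf) (rnorm_scalar sf) distrC ger0_norm// subr_ge0.
(* Rotating [u] by [v] makes its value under [h] the real number [|h u|]. *)
exists (v *: u), t^-1; split.
- by move: u1; rewrite !(in_ballE sf) (rnormZ_unit _ v1).
- rewrite (is_linearZ hL) vE -(ltr_pM2r nw0) -/(rnorm _).
  by lra.
- by rewrite normfV t1 invr1.
- by lra.
Qed.

Lemma adp_slice (S : set X) (w : X) (e : R) :
    alt_daugavet X -> is_slice_of rk (@ball_X K X) S -> w != 0 -> 0 < e ->
  exists u v, [/\ S u, `|v| = 1 & rnorm w + 1 - e < rnorm (w + v *: u)].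
Proof.
move=> adp [f [e' [fD [/(scalar_gt0 sf)[b b0 ->] ->]]]] w0 e0.
have nw0 : 0 < rnorm w by rewrite (rnorm_gt0 sf).
have [f0|/existsNP[x0 /eqP fx0]] := pselect (forall x, f x = 0); last first.
  have [M [h [M0 _ hS fE]]] := dual_normalize sf fD fx0.
  pose c := Num.min e (b / M).
  have c0 : 0 < c by rewrite lt_min e0 divr_gt0.
  have [u [v [u1 hu v1 wv]]] := adp_dual_sphere adp hS w0 c0.
  have ce : c <= e by rewrite ge_min lexx.
  have cb : c <= b / M by rewrite ge_min lexx orbT.
  exists u, v; split=> //; last by lra.
  rewrite (_ : f = fun x => i M * h x); last exact/funext.
  by apply: (slice_dual_sphere sf) => //; lra.
have re0 : re 0 = 0 by rewrite -(rmorph0 i) (scalar_reK sf).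
(* A slice of the zero functional is the whole ball, so the normalized [w] itself serves and gives
   norm exactly [|w| + 1]. *)
exists (i (rnorm w)^-1 *: w), 1; split; rewrite ?normr1//.
  split.
    by rewrite (in_ballE sf) (rnormZ_ge0 sf) ?invr_ge0 ?(ltW nw0)// mulVf ?gt_eqF.
  exists 0; rewrite f0; split; last first.
    by rewrite re0 rmorph0 sub0r oppr_lt0 -(rmorph0 i) (scalar_lt sf).
  split=> [_ [x _ <-]|y]; first by rewrite f0 re0 rmorph0.
  move/(_ 0); apply; exists 0; last by rewrite f0 re0 rmorph0.
  by rewrite (in_ballE sf) (rnorm0 sf).
have -> : w + 1 *: (i (rnorm w)^-1 *: w) = i (1 + (rnorm w)^-1) *: w.
  by rewrite scale1r rmorphD rmorph1 scalerDl scale1r.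
have nwV : 0 < (rnorm w)^-1 by rewrite invr_gt0.
rewrite (rnormZ_ge0 sf); last by lra.
by rewrite mulrDl mul1r mulVf ?gt_eqF//; lra.
Qed.

(** One functional works for all [n] because the constraints are compatible: from index [n] to [m]
    the required value grows by [m - n], and [w] moves by at most that distance. *)
Lemma norming_functional (w : nat -> X) (d : R) :
    (forall n, rnorm (w n.+1 - w n) <= 1) ->
    (forall n, n.+1%:R - d < rnorm (w n)) ->
  exists2 g : X -> R, real_linear i g & (forall x, g x <= rnorm x) /\
    forall n, n.+1%:R - d <= g (w n).
Proof.
move=> w_step w_norm.
have w_dist n m : (n <= m)%N -> rnorm (w m - w n) <= m%:R - n%:R.
  move=> /subnK <-; elim: (m - n)%N => [|k IHk].
    by rewrite add0n !subrr (rnorm0 sf).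
  have := ler_rnormD sf (w (k.+1 + n) - w (k + n)%N) (w (k + n)%N - w n).
  rewrite addrA subrK; have := w_step (k + n)%N; rewrite -addSn => ? ?.
  by rewrite addSn -natr1; lra.
(* A pair [c] is admitted when [g (w n) >= n + 1 - d] and [g <= rnorm]
   already force [c.2 <= g c.1]. *)
pose C : set (X * R) := [set c | exists n t, 0 <= t /\
  rnorm (c.1 - i t *: w n) <= t * (n.+1%:R - d) - c.2].
have w_sub (n m : nat) t : (n <= m)%N -> 0 <= t ->
    rnorm (i t *: w n - i t *: w m) <= t * (m%:R - n%:R).
  move=> nm t0; rewrite -scalerBr (rnormZ_ge0 sf)//.
  by rewrite -(rnormN (_ - _)) opprB ler_wpM2l ?w_dist.
have rnorm_sub : sublinear i (fun x : X => rnorm x).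
  split=> [x y|t x t0]; first exact: (ler_rnormD sf).
  by rewrite (rnormZ_ge0 sf) ?(ltW t0).
have [| |g g_lin [g_le gC]] := @Hahn_Banach_cone _ _ _ _ C _ rnorm_sub.
- split.
  + by exists 0, 0; rewrite rmorph0 scale0r subr0 (rnorm0 sf) mul0r subr0.
  + have CD (n m : nat) (t s : R) (c d' : X * R) : (n <= m)%N -> 0 <= t -> 0 <= s ->
      rnorm (c.1 - i t *: w n) <= t * (n.+1%:R - d) - c.2 ->
      rnorm (d'.1 - i s *: w m) <= s * (m.+1%:R - d) - d'.2 ->
      C (c.1 + d'.1, c.2 + d'.2).
      move=> nm t0 s0 cn dm; exists m, (t + s); split; first exact: addr_ge0.
      have -> /= : c.1 + d'.1 - i (t + s) *: w m = (c.1 - i t *: w n) +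
         ((d'.1 - i s *: w m) + (i t *: w n - i t *: w m)).
        rewrite rmorphD scalerDl opprD addrACA.
        by rewrite [RHS]addrCA [X in _ = _ + X]addrA subrK addrC.
      have := ler_rnormD sf (c.1 - i t *: w n)
        ((d'.1 - i s *: w m) + (i t *: w n - i t *: w m)).
      have := ler_rnormD sf (d'.1 - i s *: w m) (i t *: w n - i t *: w m).
      have := w_sub n m t nm t0.
      rewrite -(natr1 m) -(natr1 n) in cn dm *; lra.
    move=> c d' [n [t [t0 cn]]] [m [s [s0 dm]]].
    have [nm|/ltnW mn] := leqP n m; first exact: (CD n m t s).
    by rewrite addrC [c.2 + _]addrC; apply: (CD m n s t).
  + move=> s c s0 [n [t [t0 cn]]]; exists n, (s * t).
    split; first by rewrite mulr_ge0// ltW.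
    rewrite /= rmorphM -scalerA -scalerBr (rnormZ_ge0 sf) ?(ltW s0)//.
    by rewrite -mulrA -mulrBr ler_wpM2l// ltW.
- move=> c [n [t [t0 cn]]].
  have := ler_rnormD sf c.1 (i t *: w n - c.1).
  rewrite addrC subrK (rnormZ_ge0 sf)// -(rnormN (_ - _)) opprB.
  have : t * (n.+1%:R - d) <= t * rnorm (w n) by rewrite ler_wpM2l// ltW.
  lra.
exists g => //; split=> // n.
apply: (gC (w n, n.+1%:R - d)); exists n, 1; split=> //=.
by rewrite rmorph1 scale1r subrr (rnorm0 sf) mul1r subrr.
Qed.

(** Rotating [x] by a unit scalar [v] turns [|f x|] into [g (v x)], which is at most [|x|]. *)
Lemma dual_elt_norming (g : X -> R) :
    real_linear i g -> (forall x, g x <= rnorm x) ->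
  exists f : X -> K, [/\ dual_elt f, forall x, rnorm (f x) <= rnorm x &
    forall x, re (f x) = g x].
Proof.
move=> g_lin g_le; have [f fL fg] := sf_lift sf g_lin.
have f_le x : rnorm (f x) <= rnorm x.
  have [v v1 vE] := unit_scalar_mul (f x).
  by rewrite {1}/rnorm -vE -(is_linearZ fL) fg -(rnormZ_unit x v1).
exists f; split=> //; split=> //.
by apply: (@rnorm_bounded_continuous R K i re sf X K^o f 1 fL) => x; rewrite mul1r.
Qed.

(** As [g] is at least [n + 2 - d] at [w n.+1] and at most [|w n| <= n + 1] at [w n], each increment
    has value at least [1 - d]. *)
Lemma slow_growth_dual_sphere (w : nat -> X) (d : R) : d < 1 -> rnorm (w 0%N) <= 1 ->
    (forall n, rnorm (w n.+1 - w n) <= 1) ->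
    (forall n, n.+1%:R - d < rnorm (w n)) ->
  exists h, [/\ dual_sphere h, 1 - d <= re (h (w 0%N)) &
    forall n, 1 - d <= re (h (w n.+1 - w n))].
Proof.
move=> d1 w0 w_step w_norm.
have [g g_lin [g_le g_w]] := norming_functional w_step w_norm.
have w_le n : rnorm (w n) <= n.+1%:R.
  elim: n => [//|n IHn].
  have := ler_rnormD sf (w n.+1 - w n) (w n); rewrite subrK.
  by have := w_step n; rewrite -(natr1 n.+1); lra.
have gD := g_lin.1.
have g0 : 1 - d <= g (w 0%N) by have := g_w 0%N; lra.
have gS n : 1 - d <= g (w n.+1 - w n).
  have := gD (w n.+1 - w n) (w n); rewrite subrK.
  have := g_w n.+1; rewrite -(natr1 n.+1).
  by have := le_trans (g_le (w n)) (w_le n); lra.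
have [f [fD f_le fg]] := dual_elt_norming g_lin g_le.
have fw0 : f (w 0%N) != 0.
  apply/eqP => fw0; move: g0; rewrite -fg fw0 -(rmorph0 i) (scalar_reK sf); lra.
have [M [h [M0 fM hS fE]]] := dual_normalize sf fD fw0.
have M1 : M <= 1.
  rewrite -(sf_le sf) rmorph1; apply: fM.2 => _ [x x1 <-].
  rewrite -(rnormE sf) -(rmorph1 i) (sf_le sf); apply: le_trans (f_le x) _.
  by rewrite -(in_ballE sf).
(* Dividing by [M <= 1] can only increase a positive real part, and [1 - d] is positive. *)
have gh x : 1 - d <= g x -> 1 - d <= re (h x).
  rewrite -fg fE (sf_reZ sf) => hx.
  have hx0 : 0 < re (h x) by rewrite -(pmulr_rgt0 _ M0); lra.
  by apply: le_trans hx _; rewrite ler_piMl// ltW.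
by exists h; split=> // [|n]; apply: gh.
Qed.

Lemma adp_scd_lush : alt_daugavet X -> scd_set rk (@ball_X K X) -> lush rk X.
Proof.
move=> adp [_ [_ [S [S_slice S_dense]]]] x y x1 y1 e /(scalar_gt0 sf)[b b0 ->].
(* [d < b] gives the strict inequality defining the slice; [d < 1] keeps every [w n] and the norming
   functional nonzero. *)
pose d := Num.min b 1 / 2.
have [d0 d1 db] : [/\ 0 < d, d < 1 & d < b].
  by rewrite /d; case: (leP b 1) => ?; split; lra.
(* The choice must be total, so the lower bound on the norm is a premise and [(0, 0)] is the default
   when it fails. *)
pose good (p : nat * X) (q : X * K) := p.1.+1%:R - d < rnorm p.2 ->
  [/\ S p.1 q.1, `|q.2| = 1 & p.1.+2%:R - d < rnorm (p.2 + q.2 *: q.1)].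
have /choice[q qP] : forall p, exists q, good p q.
  move=> [n z]; have [nz|nz] := ltP (n.+1%:R - d) (rnorm z); last first.
    by exists (0, 0); rewrite /good /= ltNge nz.
  have z0 : z != 0.
    rewrite -(rnorm_gt0 sf); apply: le_lt_trans nz.
    by have := ler0n R n; rewrite -natr1; lra.
  (* The tolerance is the current slack: [|z| + 1] minus it is exactly [n + 2 - d], so the strict
     bound passes to the next step with the same [d]. *)
  have a0 : 0 < rnorm z - (n.+1%:R - d) by lra.
  have [u [v [Su v1 zv]]] := adp_slice adp (S_slice n) z0 a0.
  exists (u, v) => _; split=> //=; move: zv; rewrite -(natr1 n.+1); lra.
pose w n := iteri n (fun k z => z + (q (k, z)).2 *: (q (k, z)).1) x.
pose u n := (q (n, w n)).1; pose v n := (q (n, w n)).2.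
have w_norm n : n.+1%:R - d < rnorm (w n).
  elim: n => [|n IHn]; first by rewrite /w/= (rnorm_sphere sf x1); lra.
  by have [] := qP (n, w n) IHn.
have Su n : S n (u n) by have [] := qP (n, w n) (w_norm n).
have v1 n : `|v n| = 1 by have [] := qP (n, w n) (w_norm n).
have wS n : w n.+1 - w n = v n *: u n by rewrite /w/= addrC addKr.
have u_ball n : ball_X (u n).
  by have := Su n; have [f [c [_ [_ ->]]]] := S_slice n; case.
have [||h [hS hx hv]] := @slow_growth_dual_sphere w d d1 _ _ w_norm.
- by rewrite /w/= (rnorm_sphere sf x1).
- by move=> n; rewrite wS rnormZ_unit// -(in_ballE sf).
pose Sh := slice rk (@ball_X K X) h (i b).
have h_slice z : ball_X z -> 1 - d <= re (h z) -> Sh z.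
  move=> z1 hz; rewrite /Sh (_ : h = fun x => i 1 * h x).
    by apply: (slice_dual_sphere sf) => //; rewrite divr1; lra.
  by apply/funext => ?; rewrite rmorph1 mul1r.
exists h; split=> //; split.
  by apply: h_slice => //; rewrite (in_ballE sf) (rnorm_sphere sf x1).
have y_conv : cconv (range u) y.
  apply: (S_dense (range u)) => [_ [n _ <-] //|n|].
    by exists (u n); split; [exists n|].
  by rewrite (in_ballE sf) (rnorm_sphere sf y1).
have ib0 : 0 < i b by rewrite -(rmorph0 i) (scalar_lt sf).
have [z [[n [c [p [c0 [c1 [pu zE]]]]]]]] := y_conv _ (nbhsx_ballx y (i b) ib0).
rewrite -ball_normE /= => yz; exists z; split=> //.
have /choice[k kP] : forall j, exists k, p j = u k.
  by move=> j; have [k _ <-] := pu j; exists k.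
(* The slice contains the rotated points [v u], not the [u] themselves; moving the unit scalars into
   the coefficients turns the convex combination into an absolutely convex one. *)
exists n, (fun j => c j / v (k j)), (fun j => v (k j) *: u (k j)); split.
  rewrite (eq_bigr c) ?c1// => j _.
  by rewrite normrM normfV v1 invr1 mulr1 ger0_norm.
split=> [j|].
  apply: h_slice; last by rewrite -wS.
  by rewrite (in_ballE sf) (rnormZ_unit _ (v1 _)) -(in_ballE sf).
rewrite zE; apply: eq_bigr => j _; rewrite scalerA divfK ?kP//.
by rewrite -normr_gt0 v1.
Qed.


End Lush.

(** * The real and complex cases *)

Lemma scalar_field_real (R : realType) : scalar_field (idfun : {rmorphism R -> R}) id.
Proof.
split=> //; first exact: ler_norm.
move=> X g [gD gZ]; exists g => // a x y; by rewrite gD gZ.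
Qed.

Lemma scalar_field_complex (R : realType) :
  scalar_field (real_complex R : {rmorphism R -> R[i]}) (@complex.Re R).
Proof.
split.
- by move=> a b; rewrite lecR.
- exact: RRe_real.
- by move=> [? ?] [? ?].
- by move=> a [? ?] /=; rewrite mul0r subr0.
- by move=> z; apply: le_trans (normc_ge_Re z); rewrite lecR ler_norm.
move=> X g [gD gZ].
(* The usual complexification [g x - i g (i x)] of a real-linear functional. *)
exists (fun x => Complex (g x) (- g ('i%C *: x))) => // a x y.
have aE : a = real_complex R (complex.Re a) + real_complex R (complex.Im a) * 'i%C.
  by rewrite {1}[a]complexE mulrC.
have ii : 'i%C * 'i%C = - 1 :> R[i] by rewrite -expr2 sqr_i.
have gax : g (a *: x) = complex.Re a * g x + complex.Im a * g ('i%C *: x).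
  by rewrite {1}aE scalerDl -scalerA gD !gZ.
have giax : g ('i%C *: (a *: x)) = complex.Re a * g ('i%C *: x) - complex.Im a * g x.
  rewrite scalerA mulrC {1}aE mulrDl -mulrA ii mulrN1.
  by rewrite -rmorphN scalerDl -scalerA gD !gZ mulNr.
rewrite scalerDr !gD gax giax.
case: a {aE gax giax} => b c; rewrite /GRing.scale /=.
by apply/eqP; rewrite eq_complex /=; apply/andP; split; apply/eqP; ring.
Qed.

Theorem theorem4p4 :
  (* real Banach spaces *)
  (forall (R : realType) (X : completeNormedModType R),
     alt_daugavet X -> scd_set (@id R) (@ball_X _ X) -> lush (@id R) X) /\
  (* complex Banach spaces *)
  (forall (R : realType) (X : completeNormedModType R[i]),
     alt_daugavet X -> scd_set (fun z : R[i] => 'Re z) (@ball_X _ X) ->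
     lush (fun z : R[i] => 'Re z) X) /\
  (* in particular: SCD spaces with the ADP are lush *)
  (forall (R : realType) (X : completeNormedModType R),
     scd_space (@id R) X -> alt_daugavet X -> lush (@id R) X) /\
  (forall (R : realType) (X : completeNormedModType R[i]),
     scd_space (fun z : R[i] => 'Re z) X -> alt_daugavet X ->
     lush (fun z : R[i] => 'Re z) X).
Proof.
have real_lush (R : realType) (X : completeNormedModType R) :
    alt_daugavet X -> scd_set (@id R) (@ball_X _ X) -> lush (@id R) X.
  exact: (adp_scd_lush (scalar_field_real R)).
have complex_lush (R : realType) (X : completeNormedModType R[i]) :
    alt_daugavet X -> scd_set (fun z : R[i] => 'Re z) (@ball_X _ X) ->
    lush (fun z : R[i] => 'Re z) X.
  (* The [K]-valued real part ['Re z] becomes the embedding of the [R]-valued one. *)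
  under [fun z => _]funext do rewrite -complexRe.
  exact: (adp_scd_lush (scalar_field_complex R)).
(* The statements on SCD spaces reduce to the ball, which is convex and bounded by 1. *)
have scd_ball (K : numFieldType) (re : K -> K) (X : normedModType K) :
    scd_space re X -> scd_set re (@ball_X K X).
  move=> [_]; apply; last by exists 1.
  move=> x y t x1 y1 t0 t1; rewrite /ball_X /= in x1 y1 *.
  apply: le_trans (ler_normD _ _) _.
  rewrite !normrZ (ger0_norm t0) ger0_norm ?subr_ge0//.
  rewrite -[leRHS](subrKC t) lerD// ?ler_piMr// ?subr_ge0//.
by do 3![split=> //]; [move=> R X /scd_ball|move=> R X /scd_ball] => ? ?; auto.
Qed.
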